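(* Let $\Lambda=(W_j,\Lambda_j,v_j)_{j\in\mathbb{J}}$, where each $W_j$ is a closed subspace of $H$, $\Lambda_j\in\mathcal{B}(H,H_j)$ and $v_j>0$. Then $\Lambda$ is a g-fusion frame sequence if and only if the operator $T_\Lambda:\mathscr{H}_2\to H$, $T_\Lambda(\{f_j\}_{j\in\mathbb{J}})=\sum_{j\in\mathbb{J}}v_j\pi_{W_j}\Lambda_j^*f_j$, is well-defined (i.e. the series converges in $H$ for every $\{f_j\}_{j\in\mathbb{J}}\in\mathscr{H}_2$) and has closed range.
   Context: $H$ is a separable Hilbert space, $\mathbb{J}\subseteq\mathbb{Z}$, and $\{H_j\}_{j\in\mathbb{J}}$ is a family of Hilbert spaces. $\mathcal{B}(H,H_j)$ is the set of bounded linear operators from $H$ to $H_j$, and $\pi_V$ is the orthogonal projection of $H$ onto a closed subspace $V$. Series over $\mathbb{J}$ are understood with respect to a fixed enumeration of $\mathbb{J}$. $\mathscr{H}_2=\{\{f_j\}_{j\in\mathbb{J}}: f_j\in H_j,\ \sum_{j\in\mathbb{J}}\|f_j\|^2<\infty\}$ is the Hilbert space with inner product $\langle\{f_j\},\{g_j\}\rangle=\sum_j\langle f_j,g_j\rangle$. Write $M=\overline{\mathrm{span}}\{\pi_{W_j}\Lambda_j^*H_j\}_{j\in\mathbb{J}}$, the closed linear span in $H$ of all the subspaces $\pi_{W_j}\Lambda_j^*(H_j)$. $\Lambda$ is a g-fusion frame sequence if it is a g-fusion frame for $M$, i.e. there exist $0<A\le B<\infty$ such that $A\|f\|^2\le\sum_{j\in\mathbb{J}}v_j^2\|\Lambda_j\pi_{W_j}f\|^2\le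 B\|f\|^2$ for all $f\in M$. *)

(* Defs.v *)
From HB Require Import structures.
From mathcomp Require Import all_boot all_order all_algebra sesquilinear.
From mathcomp Require Import complex.
From mathcomp Require Import boolp classical_sets functions cardinality reals.
From mathcomp Require Import topology normedtype sequences.

Set Implicit Arguments.
Unset Strict Implicit.
Unset Printing Implicit Defensive.

Import Order.TTheory GRing.Theory Num.Theory.
Import numFieldNormedType.Exports.

Local Open Scope classical_set_scope.
Local Open Scope ring_scope.

(* "Hilbert space" leaves the ground field open: it is R or R[i], with the
   conjugation being the identity in the first case. *)
Variant scalar_kind := RealScalars | ComplexScalars.

Definition scalars (R : realType) (k : scalar_kind) : numFieldType :=
  match k with RealScalars => R | ComplexScalars => R[i] end.

Definition scalar_conj (R : realType) (k : scalar_kind) :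
    scalars R k -> scalars R k :=
  match k return scalars R k -> scalars R k with
  | RealScalars => idfun
  | ComplexScalars => @conjc R
  end.

(* As everywhere for normedModType K, norms are K-valued; for K = R[i] they are
   nonnegative elements of R[i], hence real. The form inner is linear in its
   first argument and theta-semilinear in the second one. *)
HB.mixin Record NormedModule_isInner (K : numFieldType) (theta : K -> K) V
    & NormedModule K V := {
  inner : {dot V for theta} ;
  inner_norm : forall x : V, inner x x = `|x| ^+ 2
}.

#[short(type="hilbertType")]
HB.structure Definition Hilbert (K : numFieldType) (theta : K -> K) :=
  {V of CompleteNormedModule K V & NormedModule_isInner K theta V}.

Definition separable (T : topologicalType) : Prop :=
  exists D : set T, countable D /\ dense D.

Section Operators.
Context {K : numFieldType} {theta : K -> K}.
Implicit Types U V : hilbertType theta.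

Definition bounded_operator U V (L : U -> V) : Prop :=
  exists C : K, forall x, `|L x| <= C * `|x|.

(* The unique z representing x |-> <L x, y>; it exists, by the Riesz
   representation theorem, when L is linear and bounded. *)
Definition adjoint U V (L : U -> V) (y : V) : U :=
  xget 0 [set z : U | forall x : U, inner (L x) y = inner x z].

Definition closed_subspace U (W : set U) : Prop :=
  [/\ closed W, W 0 & forall (a : K) x y, W x -> W y -> W (a *: x + y)].

(* The unique y in W such that x - y is orthogonal to W; it exists when W is a
   closed subspace. *)
Definition proj U (W : set U) (x : U) : U :=
  xget 0 [set y : U | W y /\ forall z : U, W z -> inner (x - y) z = 0].

Definition linear_span U (A : set U) : set U :=
  [set x | exists (n : nat) (c : 'I_n -> K) (a : 'I_n -> U),
     (forall i, A (a i)) /\ x = \sum_(i < n) c i *: a i].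

End Operators.

(* An enumeration of a countable, possibly finite, type: the indices n with
   e n <> None form an initial segment of nat, in bijection with I. *)
Definition enumeration (I : Type) (e : nat -> option I) : Prop :=
  [/\ forall m n i, e m = Some i -> e n = Some i -> m = n,
      forall i, exists n, e n = Some i
    & forall n, e n = None -> e n.+1 = None].

Section SeriesAlong.
Context {I : Type} (e : nat -> option I).
Context {K : numFieldType} {V : normedModType K}.

Definition series_along (u : I -> V) : nat -> V :=
  series (fun n => if e n is Some i then u i else 0).

Definition convergent_along (u : I -> V) : Prop := cvgn (series_along u).

Definition sum_along (u : I -> V) : V := limn (series_along u).

End SeriesAlong.

Section GFusion.
Context {K : numFieldType} {theta : K -> K} {H : hilbertType theta}.
Context {I : Type} (e : nat -> option I) {HI : I -> hilbertType theta}.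

(* The underlying set of the Hilbert space H_2. *)
Definition ell2 : set (forall i, HI i) :=
  [set f | convergent_along e (fun i => `|f i| ^+ 2 : K)].

Context (W : I -> set H) (L : forall i, {linear H -> HI i}) (v : I -> K).

(* A series of nonnegative terms that diverges has sum +oo and thus violates
   the upper bound, whence the convergence clause. *)
Definition g_fusion_frame_for (M : set H) : Prop :=
  exists A B : K, [/\ 0 < A, A <= B & forall f : H, M f ->
    let u i := v i ^+ 2 * `|L i (proj (W i) f)| ^+ 2 : K in
    [/\ convergent_along e u,
        A * `|f| ^+ 2 <= sum_along e u
      & sum_along e u <= B * `|f| ^+ 2]].

Definition closed_span_of_ranges : set H :=
  closure (linear_span
    (\bigcup_(i in [set: I]) range (fun y => proj (W i) (adjoint (L i) y)))).

Definition g_fusion_frame_sequence : Prop :=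
  g_fusion_frame_for closed_span_of_ranges.

Definition synthesis_term (f : forall i, HI i) (i : I) : H :=
  v i *: proj (W i) (adjoint (L i) (f i)).

Definition synthesis (f : forall i, HI i) : H :=
  sum_along e (synthesis_term f).

End GFusion.

(* Main.v *)
Require Import Defs.
From HB Require Import structures.
From mathcomp Require Import all_boot all_order all_algebra sesquilinear.
From mathcomp Require Import complex.
From mathcomp Require Import boolp classical_sets functions cardinality reals.
From mathcomp Require Import topology normedtype sequences.
From mathcomp Require Import ring lra.

(** Put [a_j = v_j Lambda_j pi_(W_j)], so that [a_j^* = v_j pi_(W_j) Lambda_j^*]
    and [T c = sum_j a_j^* c_j]. The vectors [a_j^* y] span a dense subspace of
    [M], and the frame inequality bounds the norm of the analysis [(a_j f)_j] of
    [f] from both sides. Everything rests on the identity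
    [<T c, f> = sum_j <c_j, a_j f>].

    If the frame inequality holds, its upper half bounds the blocks of the
    series [T c] by those of [sum_j |c_j|^2] ([synthesis_block_le]), so the series
    converges, to a vector of [M]. Its lower half says that the frame operator
    [f |-> T (a_j f)_j] is coercive on [M]; by Lax and Milgram it maps onto [M]
    ([frame_synthesis_onto]), and the range of [T] is the closed subspace [M].

    Conversely, let [T] be well-defined with closed range. Convergence of
    [sum_j <c_j, a_j h>] for all square-summable [c] forces the analysis of every
    [h] to be square-summable ([analysis_ell2], by the Abel-Dini theorem), so the
    images under the partial sums of [T] of the unit ball of coefficients are
    weakly bounded. By the uniform boundedness principle they are bounded, and
    dually the upper frame bound holds ([analysis_bessel]). The range of [T] is a
    closed subspace that contains all [a_j^* y], hence contains [M]. Therefore each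
    [x] in [M] is some [T c], and [|<x, z>| <= |c|] for all [z] in [M] whose
    analysis has norm at most 1: such [z] are weakly bounded in [M], hence bounded,
    which is the lower frame bound ([analysis_lower_bound]).

    The argument is the same for both kinds of scalars. It is carried out for
    real Hilbert spaces with the real part of the inner product, the given spaces
    being regarded as real ones without changing their topology ([realified]). The
    projections [pi_W] and the adjoints [Lambda_j^*] exist by the projection and
    Riesz theorems, which are proved for real spaces and transferred back. *)

Set Implicit Arguments.
Unset Strict Implicit.
Unset Printing Implicit Defensive.

Import Order.TTheory GRing.Theory Num.Theory.
Import numFieldNormedType.Exports.

Local Open Scope classical_set_scope.
Local Open Scope ring_scope.

(** * Real and complex scalars *)

Section Scalars.
Context {R : realType} {k : scalar_kind}.
Implicit Types (r s : R) (x y : scalars R k).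

Definition emb : R -> scalars R k :=
  match k return R -> scalars R k with
  | RealScalars => idfun
  | ComplexScalars => real_complex R
  end.

Definition re : scalars R k -> R :=
  match k return scalars R k -> R with
  | RealScalars => idfun
  | ComplexScalars => @complex.Re R
  end.

Fact emb_is_zmod_morphism : zmod_morphism emb.
Proof. by rewrite /emb; case: k => // a b; rewrite rmorphB. Qed.
Fact emb_is_monoid_morphism : monoid_morphism emb.
Proof. by rewrite /emb; case: k; split => // a b; rewrite rmorphM. Qed.
HB.instance Definition _ :=
  GRing.isZmodMorphism.Build R (scalars R k) emb emb_is_zmod_morphism.
HB.instance Definition _ :=
  GRing.isMonoidMorphism.Build R (scalars R k) emb emb_is_monoid_morphism.

Fact re_is_zmod_morphism : zmod_morphism re.
Proof. by rewrite /re; case: k => //= -[a b] [c d]. Qed.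
HB.instance Definition _ :=
  GRing.isZmodMorphism.Build (scalars R k) R re re_is_zmod_morphism.

Lemma embK : cancel emb re.
Proof. by rewrite /re /emb; case: k. Qed.

Lemma emb_re x : 0 <= x -> emb (re x) = x.
Proof. by rewrite /re /emb; case: k x => //= x /ger0_real/RRe_real. Qed.

Lemma reZ r x : re (emb r * x) = r * re x.
Proof. by rewrite /re /emb; case: k x => //= -[a b] /=; rewrite mul0r subr0. Qed.

Lemma ler_emb : {mono emb : r s / r <= s}.
Proof. by rewrite /emb; case: k => //= r s; rewrite lecE /= eqxx. Qed.

Lemma ltr_emb : {mono emb : r s / r < s}.
Proof. by move=> r s; rewrite !lt_neqAle ler_emb (inj_eq (can_inj embK)). Qed.

Lemma emb_ge0 r : (0 <= emb r) = (0 <= r).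
Proof. by rewrite -{1}(rmorph0 emb) ler_emb. Qed.

Lemma norm_emb r : `|emb r| = emb `|r|.
Proof.
case: (lerP 0 r) => r0; first by rewrite !ger0_norm ?emb_ge0.
by rewrite !ltr0_norm ?rmorphN// -(rmorph0 emb) ltr_emb.
Qed.

Lemma emb_norm_re x : emb `|re x| <= `|x|.
Proof.
by rewrite /re /emb; case: k x => //= x; exact: normc_ge_Re.
Qed.

Lemma re_conj x : re (scalar_conj x) = re x.
Proof. by rewrite /re /scalar_conj; case: k x => //= -[a b]. Qed.

Lemma scalar_conj_emb r : scalar_conj (emb r) = emb r.
Proof. by rewrite /emb /scalar_conj; case: k => //=; exact: conjc_real. Qed.

(** This is how identities between inner products are recovered from their
    real parts: if [re (inner x z)] vanishes for all [z] in a subspace over the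
    scalars, then so does [inner x z], as [z] may be multiplied by [inner x z]. *)
Lemma re_conjM_eq0 x : re (scalar_conj x * x) = 0 -> x = 0.
Proof.
rewrite /re /scalar_conj; case: k x => //= x.
  by move/eqP; rewrite mulf_eq0 orbb => /eqP.
case: x => a b /=; rewrite mulNr opprK -!expr2 => /eqP.
by rewrite paddr_eq0 ?sqr_ge0// !sqrf_eq0 => /andP[/eqP-> /eqP->].
Qed.

End Scalars.
Arguments emb {R} k.

(** * A Hilbert space as a real Hilbert space *)

Section Inner.
Context {K : numFieldType} {theta : K -> K} {H : hilbertType theta}.
Implicit Types (a : K) (x y z : H).

Lemma inner_conj x y : inner x y = theta (inner y x).
Proof. by rewrite [LHS]hermitian_subproof expr0 mul1r. Qed.
Lemma innerDl x y z : inner (x + y) z = inner x z + inner y z.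
Proof. exact: (linearDl inner). Qed.
Lemma innerDr x y z : inner z (x + y) = inner z x + inner z y.
Proof. exact: (linearDr inner). Qed.
Lemma innerBl x y z : inner (x - y) z = inner x z - inner y z.
Proof. exact: (linearBl inner). Qed.
Lemma innerBr x y z : inner z (x - y) = inner z x - inner z y.
Proof. exact: (linearBr inner). Qed.
Lemma inner0l x : inner 0 x = 0.
Proof. exact: (linear0l inner). Qed.
Lemma innerZl a x y : inner (a *: x) y = a * inner x y.
Proof. exact: (linearZl_LR inner). Qed.
Lemma innerZr a x y : inner x (a *: y) = theta a * inner x y.
Proof. exact: (linearZr_LR inner). Qed.

End Inner.

Section Realification.
Context {R : realType} {k : scalar_kind}.

(** The restriction of scalars of [H] to [R], with the real part of the inner
    product. It is an alias of [H] whose uniform structure is that of [H]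
    itself, so that closedness, convergence, limits and sums mean
    definitionally the same in both spaces; only norms and scalars change. *)
Definition realified (H : hilbertType (@scalar_conj R k)) : Type := H.

Section Def.
Variable H : hilbertType (@scalar_conj R k).
Local Notation V := (realified H).

HB.instance Definition _ := GRing.Zmodule.copy V H.
HB.instance Definition _ := Complete.copy V H.

Definition rscale (r : R) (x : V) : V := emb k r *: (x : H).
Definition rnorm (x : V) : R := re `|x : H|.
Definition rinner (x y : V) : R := re (inner (x : H) (y : H)).

Fact rscaleA r s x : rscale r (rscale s x) = rscale (r * s) x.
Proof. by rewrite /rscale scalerA rmorphM. Qed.
Fact rscale1 : left_id 1 rscale.
Proof. by move=> x; rewrite /rscale rmorph1 scale1r. Qed.
Fact rscaleDr : right_distributive rscale +%R.
Proof. by move=> r x y; rewrite /rscale scalerDr. Qed.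
Fact rscaleDl x : {morph rscale^~ x : r s / r + s}.
Proof. by move=> r s; rewrite /rscale rmorphD scalerDl. Qed.
HB.instance Definition _ := GRing.Zmodule_isLmodule.Build R V
  rscaleA rscale1 rscaleDr rscaleDl.

Lemma emb_rnorm x : emb k (rnorm x) = `|x : H|.
Proof. exact: emb_re. Qed.

Fact rnormD x y : rnorm (x + y) <= rnorm x + rnorm y.
Proof. by rewrite -(@ler_emb _ k) rmorphD/= !emb_rnorm ler_normD. Qed.
Fact rnorm0_eq0 x : rnorm x = 0 -> x = 0.
Proof.
by move=> /(congr1 (emb k)); rewrite emb_rnorm rmorph0 => /eqP; rewrite normr_eq0 => /eqP.
Qed.
Fact rnormZ r x : rnorm (rscale r x) = `|r| * rnorm x.
Proof. by rewrite /rnorm /rscale normrZ norm_emb reZ. Qed.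
Fact rnormMn x n : rnorm (x *+ n) = rnorm x *+ n.
Proof. by rewrite /rnorm normrMn raddfMn. Qed.
Fact rnormN x : rnorm (- x) = rnorm x.
Proof. by rewrite /rnorm normrN. Qed.
HB.instance Definition _ := Num.Zmodule_isNormed.Build R V
  rnormD rnorm0_eq0 rnormMn rnormN.

Definition rball (x : V) (e : R) (y : V) : Prop := `|x - y| < e.

Lemma rballE x (e : R) : rball x e = ball (x : H) (emb k e).
Proof.
apply/funext => y; rewrite -ball_normE /ball_ /=.
by rewrite -[`|_ - _ : H|](emb_rnorm (x - y)) ltr_emb.
Qed.
Fact rball_center x (e : R) : 0 < e -> rball x e x.
Proof. by rewrite /rball subrr normr0. Qed.
Fact rball_sym x y (e : R) : rball x e y -> rball y e x.
Proof. by rewrite /rball distrC. Qed.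
Fact rball_triangle x y z (e1 e2 : R) :
  rball x e1 y -> rball y e2 z -> rball x (e1 + e2) z.
Proof.
by rewrite /rball => xy yz; rewrite (le_lt_trans (ler_distD y _ _))// ltrD.
Qed.
Fact rball_entourage : entourage = entourage_ rball.
Proof.
transitivity (entourage_ (@ball _ H)).
  exact: (@entourageE_subproof _ H).
apply/seteqP; split => A [e /= e0 eA].
  exists (re e) => /=.
    by rewrite -(@ltr_emb _ k) rmorph0 emb_re ?ltW.
  by move=> [x y] /=; rewrite rballE emb_re ?ltW// => xy; exact: (eA (x, y)).
exists (emb k e); first by rewrite /= -(rmorph0 (emb k)) ltr_emb.
by move=> [x y] /=; rewrite -rballE => xy; exact: (eA (x, y)).
Qed.
HB.instance Definition _ := Uniform_isPseudoMetric.Build R V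
  rball_center rball_sym rball_triangle rball_entourage.
HB.instance Definition _ := NormedZmod_PseudoMetric_eq.Build R V erefl.
HB.instance Definition _ :=
  PseudoMetricNormedZmod_Lmodule_isNormedModule.Build R V rnormZ.

Fact rinner_bilinear :
  bilinear_for ( *%R : R -> R -> R) (idfun \; *%R : R -> R -> R) rinner.
Proof.
split=> [y|y] r x z /=; rewrite /rinner -reZ -raddfD; congr re.
  by rewrite -innerZl -innerDl.
by rewrite -{1}(@scalar_conj_emb R k r) -innerZr -innerDr.
Qed.
HB.instance Definition _ := bilinear_isBilinear.Build R V V R
  ( *%R) (idfun \; *%R) rinner rinner_bilinear.
Fact rinner_hermitian (x y : V) :
  rinner x y = (-1) ^+ false * idfun (rinner y x).
Proof. by rewrite expr0 mul1r /rinner inner_conj re_conj. Qed.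
HB.instance Definition _ :=
  isHermitianSesquilinear.Build R V false idfun rinner rinner_hermitian.
Fact rinner_norm (x : V) : rinner x x = `|x| ^+ 2.
Proof.
apply: (can_inj (@embK R k)).
by rewrite rmorphXn/= emb_rnorm -inner_norm emb_re// inner_norm exprn_ge0.
Qed.
Fact rinner_gt0 (x : V) : x != 0 -> 0 < rinner x x.
Proof. by move=> x0; rewrite rinner_norm exprn_gt0// normr_gt0. Qed.
HB.instance Definition _ := isDotProduct.Build R V rinner rinner_gt0.
HB.instance Definition _ :=
  NormedModule_isInner.Build R idfun V rinner_norm.

End Def.
End Realification.

(** * Projection, Riesz and Lax-Milgram theorems *)

Section RealHilbert.
Context {R : realType} {V : hilbertType (@idfun R)}.
Implicit Types (x y z : V) (r : R) (M : set V).

Lemma innerC x y : inner x y = inner y x.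
Proof. exact: inner_conj. Qed.

Lemma innerNl x y : inner (- x) y = - inner x y.
Proof. by rewrite -scaleN1r innerZl mulN1r. Qed.

Lemma sqr_normD x y : `|x + y| ^+ 2 = `|x| ^+ 2 + 2 * inner x y + `|y| ^+ 2.
Proof.
rewrite -!inner_norm innerDl !innerDr (innerC y x).
by rewrite mulr_natl mulr2n !addrA.
Qed.

Lemma sqr_normZ r x : `|r *: x| ^+ 2 = r ^+ 2 * `|x| ^+ 2.
Proof. by rewrite normrZ exprMn real_normK// num_real. Qed.

Lemma parallelogram x y :
  `|x + y| ^+ 2 + `|x - y| ^+ 2 = 2 * `|x| ^+ 2 + 2 * `|y| ^+ 2.
Proof.
by rewrite !sqr_normD normrN (innerC x (- y)) innerNl (innerC y); ring.
Qed.

Lemma normr_sqr_eq0 x : `|x| ^+ 2 = 0 -> x = 0.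
Proof. by move=> /eqP; rewrite sqrf_eq0 normr_eq0 => /eqP. Qed.

Lemma inner_le_norm x y : inner x y <= `|x| * `|y|.
Proof.
have [->|x0] := eqVneq x 0; first by rewrite inner0l normr0 mul0r.
have [->|y0] := eqVneq y 0; first by rewrite innerC inner0l normr0 mulr0.
have nx : 0 < `|x| by rewrite normr_gt0.
have ny : 0 < `|y| by rewrite normr_gt0.
have := sqr_ge0 (`| `|y| *: x - `|x| *: y|).
rewrite sqr_normD normrN !sqr_normZ innerC innerNl innerC innerZl innerC innerZl.
rewrite (innerC y x) => h.
have : 0 <= (2 * (`|x| * `|y|)) * (`|x| * `|y| - inner x y) by lra.
by rewrite pmulr_rge0 ?subr_ge0// !mulr_gt0.
Qed.

Lemma cauchy_schwarz x y : `|inner x y| <= `|x| * `|y|.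
Proof.
rewrite ler_norml inner_le_norm andbT lerNl -innerNl.
by rewrite -(normrN x) inner_le_norm.
Qed.

(** Young's inequality. It replaces Cauchy-Schwarz wherever finite sums
    are estimated, since it can be summed term by term. *)
Lemma inner_le_sqr (t : R) x y : 0 < t ->
  2 * inner x y <= t * `|x| ^+ 2 + t^-1 * `|y| ^+ 2.
Proof.
move=> t0; have := sqr_ge0 (`|t *: x - y|).
rewrite sqr_normD normrN sqr_normZ (innerC _ (- y)) innerNl (innerC y) innerZl.
move=> h; rewrite -(ler_pM2l t0) mulrDr mulrA [t * (t^-1 * _)]mulrA mulfV ?gt_eqF//.
by lra.
Qed.

Lemma cvg_inner (u : nat -> V) x z :
  u @ \oo --> x -> (fun n => inner (u n) z) @ \oo --> inner x z.
Proof.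
move=> ux; apply/cvgrPdist_le => e e0.
have z1 : 0 < `|z| + 1 by rewrite ltr_wpDl.
have e1 : 0 < e / (`|z| + 1) by rewrite divr_gt0.
move/cvgrPdist_le : ux => /(_ _ e1); apply: filterS => n xun.
rewrite -innerBl (le_trans (cauchy_schwarz _ _))//.
rewrite (le_trans (ler_wpM2r _ xun))// mulrAC ler_pdivrMr//.
by rewrite ler_wpM2l ?(ltW e0)// lerDl.
Qed.

Lemma cvg_of_dist (u : nat -> V) (b : nat -> R) : b @ \oo --> 0 ->
  (forall m n, (m <= n)%N -> `|u n - u m| ^+ 2 <= b m) -> cvgn u.
Proof.
move=> b0 ub; apply/cauchy_cvgP/cauchy_exP => e e0.
have : 0 < e ^+ 2 by rewrite exprn_gt0.
move/cvgrPdist_lt : b0 => /[apply] -[N _ bN].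
exists (u N); exists N => // n /= Nn; rewrite -ball_normE /= distrC.
rewrite -ltr_sqr ?nnegrE ?(ltW e0)// (le_lt_trans (ub _ _ Nn))//.
by have := bN N (leqnn N); rewrite sub0r normrN; apply: le_lt_trans; exact: ler_norm.
Qed.

Lemma closed_subspaceD M x y : closed_subspace M -> M x -> M y -> M (x + y).
Proof. by move=> [_ _ Ml] Mx My; rewrite -[x]scale1r; exact: Ml. Qed.

Lemma closed_subspaceZ M r x : closed_subspace M -> M x -> M (r *: x).
Proof. by move=> [_ M0 Ml] Mx; rewrite -[_ *: _]addr0; exact: Ml. Qed.

Lemma closed_subspaceB M x y : closed_subspace M -> M x -> M y -> M (x - y).
Proof.
move=> sM Mx My; apply: closed_subspaceD => //.
by rewrite -scaleN1r; exact: closed_subspaceZ.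
Qed.

Lemma cvg_closed M (u : nat -> V) x :
  closed M -> (forall n, M (u n)) -> u @ \oo --> x -> M x.
Proof. by move=> cM Mu; apply: closed_cvg => //; apply: nearW. Qed.

Lemma closure_approx (A : set V) x (e : R) : closure A x -> 0 < e ->
  exists2 y, A y & `|x - y| < e.
Proof.
move=> /(_ (ball x e)) Ax e0.
have [y [Ay]] := Ax (nbhsx_ballx x e e0).
by rewrite -ball_normE; exists y.
Qed.

Lemma closure_cvg (A : set V) x : closure A x ->
  exists2 u : nat -> V, forall n, A (u n) & u @ \oo --> x.
Proof.
move=> Ax.
have /choice[u uP] (n : nat) : exists y, A y /\ `|x - y| < n.+1%:R^-1.
  have n0 : 0 < n.+1%:R^-1 :> R by rewrite invr_gt0.
  by have [y Ay xy] := closure_approx Ax n0; exists y.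
exists u => [n|]; first by have [] := uP n.
apply/cvgrPdist_lt => e e0.
have := @cvg_harmonic R => /cvgrPdist_lt /(_ _ e0).
apply: filterS => n /=; rewrite sub0r normrN => ne.
have [_ /lt_le_trans] := uP n; apply.
by rewrite (le_trans _ (ltW ne))// ler_norm.
Qed.

(** The vectors of [M] along which the distance to [x] approaches its infimum
    form a Cauchy sequence by the parallelogram identity, and its limit, a
    closest point of [M], differs from [x] by a vector orthogonal to [M]. *)
Lemma projection_exists M x : closed_subspace M ->
  exists2 y, M y & forall z, M z -> inner (x - y) z = 0.
Proof.
move=> sM; have [cM M0 _] := sM.
pose D := [set `|x - w| ^+ 2 | w in M].
have D0 : has_inf D.
  by split; [exists (`|x - 0| ^+ 2), 0 | exists 0 => _ [w _ <-]; exact: sqr_ge0].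
have infD w : M w -> inf D <= `|x - w| ^+ 2.
  by move=> Mw; apply: ge_inf; [exact: D0.2 | exists w].
have /choice[w wP] (n : nat) :
    exists w, M w /\ `|x - w| ^+ 2 < inf D + n.+1%:R^-1.
  have n0 : 0 < n.+1%:R^-1 :> R by rewrite invr_gt0.
  by have [_ [w Mw <-] lt_w] := inf_adherent n0 D0; exists w.
have Mw n : M (w n) by have [] := wP n.
have cw : cvgn w.
  apply: (cvg_of_dist (b := fun m => 4 * m.+1%:R^-1)).
    by rewrite -(mulr0 4); apply: cvgM; [exact: cvg_cst | exact: cvg_harmonic].
  move=> m n mn.
  have := infD _ (closed_subspaceZ 2^-1 sM (closed_subspaceD sM (Mw m) (Mw n))).
  have := parallelogram (x - w m) (x - w n).
  have -> : x - w m - (x - w n) = w n - w m.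
    by rewrite opprB addrC addrA subrK.
  have -> : x - w m + (x - w n) = 2 *: (x - 2^-1 *: (w m + w n)).
    rewrite scalerBr scalerA mulfV ?pnatr_eq0//.
    by rewrite scale1r scaler_nat mulr2n addrACA opprD.
  rewrite sqr_normZ.
  have [_] := wP m; have [_] := wP n.
  have : n.+1%:R^-1 <= m.+1%:R^-1 :> R by rewrite lef_pV2 ?posrE// ler_nat.
  move: (n.+1%:R^-1) (m.+1%:R^-1) (inf D) => en em d.
  by lra.
have My : M (limn w) by exact: cvg_closed cw.
have ley : `|x - limn w| ^+ 2 <= inf D.
  apply/ler_addgt0Pr => e e0.
  have cxw : (fun n => `|x - w n| ^+ 2) @ \oo --> `|x - limn w| ^+ 2.
    rewrite expr2; under eq_fun do rewrite expr2.
    by apply: cvgM; apply: cvg_norm; apply: cvgB => //; exact: cvg_cst.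
  apply: (@closed_cvg _ _ _ _ _ (fun t : R => t <= inf D + e) _ _ _ cxw).
    exact: closed_le.
  have := @cvg_harmonic R => /cvgrPdist_lt /(_ _ e0); apply: filterS => n /=.
  rewrite sub0r normrN => ne; have [_ /ltW/le_trans] := wP n; apply.
  by rewrite lerD2l (le_trans (ler_norm _))// ltW.
exists (limn w) => // z Mz; have [->|z0] := eqVneq z 0.
  by rewrite innerC inner0l.
have nz : 0 < `|z| ^+ 2 by rewrite exprn_gt0// normr_gt0.
set u := x - limn w in ley *; pose t := inner u z / `|z| ^+ 2.
(* compare [limn w] with the best competitor on the line through it along z *)
have := infD _ (closed_subspaceD sM My (closed_subspaceZ t sM Mz)).
have -> : x - (limn w + t *: z) = u + - t *: z by rewrite opprD addrA scaleNr.
move=> /(le_trans ley); rewrite sqr_normD sqr_normZ innerC innerZl innerC sqrrN.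
have -> : t ^+ 2 * `|z| ^+ 2 = t * inner u z.
  by rewrite expr2 -mulrA divfK ?gt_eqF.
move=> h; have : t * inner u z <= 0 by lra.
rewrite /t mulrAC -expr2 pmulr_lle0 ?invr_gt0// => h2.
by apply/eqP; rewrite -sqrf_eq0 eq_le h2 sqr_ge0.
Qed.

(** A vector orthogonal to the kernel of [phi] represents [phi] up to a
    factor, because [phi u *: x - phi x *: u] always lies in the kernel. *)
Lemma riesz (phi : V -> R) (C : R) :
  (forall r x y, phi (r *: x + y) = r * phi x + phi y) ->
  (forall x, `|phi x| <= C * `|x|) ->
  exists z, forall x, phi x = inner x z.
Proof.
move=> phiL phiC.
have phi0 : phi 0 = 0.
  by apply/eqP; rewrite -normr_le0 (le_trans (phiC 0))// normr0 mulr0.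
have phiD x y : phi (x + y) = phi x + phi y.
  by have := phiL 1 x y; rewrite scale1r mul1r.
have phiZ r x : phi (r *: x) = r * phi x.
  by have := phiL r x 0; rewrite !addr0 phi0 addr0.
have sN : closed_subspace [set x | phi x = 0].
  split => //= [x Nx|r x y Nx Ny]; last by rewrite phiL Nx Ny mulr0 addr0.
  have C1 : 0 < `|C| + 1 by rewrite ltr_wpDl.
  apply/eqP; rewrite -normr_le0; apply/ler_addgt0Pl => e e0.
  have eC0 : 0 < e / (`|C| + 1) by rewrite divr_gt0.
  have [y /= y0 xy] := closure_approx Nx eC0.
  have -> : phi x = phi (x - y).
    by rewrite phiD -scaleN1r phiZ y0 mulr0 addr0.
  rewrite addr0 (le_trans (phiC _))//.
  apply: (@le_trans _ _ ((`|C| + 1) * `|x - y|)).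
    by rewrite ler_wpM2r// (le_trans (ler_norm C))// lerDl.
  by rewrite mulrC -ler_pdivlMr// ltW.
have [phi_eq0|/existsNP[x0 x0N]] := pselect (forall x, phi x = 0).
  by exists 0 => x; rewrite innerC inner0l.
have [p /= pN orth] := projection_exists x0 sN.
set u := x0 - p in orth.
have phiu : phi u = phi x0 by rewrite phiD -scaleN1r phiZ pN mulr0 addr0.
have u0 : `|u| ^+ 2 != 0.
  apply/eqP => /normr_sqr_eq0 u0; apply: x0N.
  by rewrite -phiu u0.
exists ((phi u / `|u| ^+ 2) *: u) => x.
have := orth (phi u *: x - phi x *: u).
rewrite /= phiD phiZ -scaleNr phiZ mulrC mulNr subrr => /(_ erefl).
rewrite innerC innerDl !innerZl inner_norm mulNr => /subr0_eq h.
by rewrite innerC innerZl innerC mulrAC h mulfK.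
Qed.

(** The uniform boundedness principle for the functionals [inner ^~ z].
    Testing on [M] is enough, since [z] only sees the projection on [M] of its
    argument. *)
Lemma weakly_bounded_norm_bounded M (Z : set V) : closed_subspace M ->
  Z `<=` M -> (forall x, M x -> exists C, forall z, Z z -> inner x z <= C) ->
  exists C, forall z, Z z -> `|z| <= C.
Proof.
move=> sM ZM wb.
pose F := [set (fun x => inner x z : R) | z in Z].
have [| |C FC] := @Banach_Steinhauss R V R F _ _ 1.
- move=> _ [z Zz <-]; split.
    move=> r; exists (r * `|z|) => x xr.
    by rewrite (le_trans (cauchy_schwarz _ _))// ler_wpM2r.
  by move=> r x y; rewrite innerDl innerZl.
- move=> x; have [p Mp orth] := projection_exists x sM.
  have [C1 C1P] := wb _ Mp.
  have [C2 C2P] := wb _ (closed_subspaceZ (-1) sM Mp).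
  exists (Num.max C1 C2) => _ [z Zz <-].
  have -> : inner x z = inner p z.
    by apply/eqP; rewrite -subr_eq0 -innerBl orth//; exact: ZM.
  rewrite ler_norml lerNl; apply/andP; split.
    by rewrite le_max -innerNl -scaleN1r C2P ?orbT.
  by rewrite le_max C1P.
exists C => z Zz; have [->|z0] := eqVneq z 0.
  have := FC _ (ex_intro2 _ _ z Zz erefl) 0; rewrite !normr0 => /(_ ler01).
  exact: le_trans.
have nz : 0 < `|z| by rewrite normr_gt0.
have := FC _ (ex_intro2 _ _ z Zz erefl) (`|z|^-1 *: z).
rewrite normrZ normfV normr_id mulVf ?gt_eqF// => /(_ (lexx _)).
by rewrite innerZl inner_norm expr2 mulKf ?gt_eqF// normr_id.
Qed.

(** Homogeneous form of the uniform boundedness principle, where [E z s] says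
    that [s] bounds the square of some gauge of [z]. Both frame bounds come from
    it: the upper one with the gauge of the coefficients of [z], the lower one
    with the gauge given by the analysis of [z]. *)
Lemma weakly_bounded_quadratic M (E : V -> R -> Prop) : closed_subspace M ->
  (forall z s, E z s -> M z) -> (forall z s, E z s -> 0 <= s) ->
  (forall r z s, E z s -> E (r *: z) (r ^+ 2 * s)) ->
  (forall x, M x -> exists C, forall z s, E z s -> s <= 1 -> inner x z <= C) ->
  exists2 D, 0 < D & forall z s, E z s -> `|z| ^+ 2 <= D * s.
Proof.
move=> sM EM E0 EZ wb.
have [||C CP] := @weakly_bounded_norm_bounded M
    [set z | exists2 s, E z s & s <= 1] sM.
- by move=> z [s /EM].
- move=> x /wb[C CP]; exists C => z [s Ezs s1]; exact: CP Ezs s1.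
have C0 : 0 < `|C| + 1 by rewrite ltr_wpDl.
exists ((`|C| + 1) ^+ 2); first by rewrite exprn_gt0.
move=> z s Ezs; apply/ler_addgt0Pr => e e0.
(* [e'] keeps the rescaling by 1/sqrt (s + e') meaningful when s = 0 *)
set D := (`|C| + 1) ^+ 2; have D0 : 0 < D by rewrite exprn_gt0.
pose e' := e / D; have e'0 : 0 < e' by rewrite divr_gt0.
have se0 : 0 < s + e' by rewrite ltr_wpDl// (E0 _ _ Ezs).
pose r := (Num.sqrt (s + e'))^-1.
have r2 : r ^+ 2 = (s + e')^-1 by rewrite exprVn sqr_sqrtr// ltW.
have : `|r *: z| <= C.
  apply: CP; exists (r ^+ 2 * s); first exact: EZ.
  by rewrite r2 mulrC ler_pdivrMr// mul1r lerDl ltW.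
move=> rzC; have : `|r *: z| ^+ 2 <= D.
  rewrite /D ler_sqr ?nnegrE ?(ltW C0)// (le_trans rzC)//.
  by rewrite (le_trans (ler_norm _))// lerDl.
rewrite sqr_normZ r2 mulrC ler_pdivrMr// mulrDr.
by rewrite /e' [D * (e / D)]mulrC divfK ?gt_eqF.
Qed.

(** Coercivity makes the range of [S] on [M] closed, by bounding [S] from
    below, and leaves no nonzero vector of [M] orthogonal to this range. *)
Lemma lax_milgram M (S : V -> V) (A C : R) : closed_subspace M ->
  (forall x, M x -> M (S x)) ->
  (forall r x y, M x -> M y -> S (r *: x + y) = r *: S x + S y) ->
  (forall x, M x -> `|S x| <= C * `|x|) ->
  0 < A -> (forall x, M x -> A * `|x| ^+ 2 <= inner (S x) x) ->
  forall y, M y -> exists2 x, M x & S x = y.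
Proof.
move=> sM SM SL SC A0 SA.
have [cM M0 Ml] := sM.
have SB x y : M x -> M y -> S (x - y) = S x - S y.
  by move=> Mx My; rewrite addrC -scaleN1r SL// scaleN1r addrC.
have S0 : S 0 = 0 by have := SB 0 0 M0 M0; rewrite !subrr.
have SAn x : M x -> A * `|x| <= `|S x|.
  move=> Mx; have [->|x0] := eqVneq x 0; first by rewrite normr0 mulr0.
  rewrite -(@ler_pM2r _ `|x|) ?normr_gt0// -mulrA -expr2.
  exact: le_trans (SA _ Mx) (inner_le_norm _ _).
have sSM : closed_subspace [set S x | x in M].
  split; [|by exists 0|].
    move=> y /closure_cvg[v Sv vy].
    have /choice[u uP] n : exists x, M x /\ S x = v n.
      by have [x] := Sv n; exists x.
    have Mu n : M (u n) by have [] := uP n.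
    have SAB m n : A * `|u n - u m| <= `|v n - v m|.
      rewrite -(uP n).2 -(uP m).2 -SB// SAn//; exact: closed_subspaceB.
    have cu : cvgn u.
      apply/cauchy_cvgP/cauchy_exP => e e0.
      have Ae0 : 0 < A * e / 2 by rewrite divr_gt0// mulr_gt0.
      move/cvgrPdist_lt : (vy) => /(_ _ Ae0)[N _ vN].
      exists (u N); exists N => // n /= Nn; rewrite -ball_normE /= distrC.
      rewrite -(ltr_pM2l A0) (le_lt_trans (SAB _ _))//.
      rewrite (le_lt_trans (ler_distD y _ _))// distrC [ltRHS]splitr.
      by rewrite ltrD//; apply: vN => //=.
    have Mlu : M (limn u) by exact: cvg_closed cu.
    exists (limn u) => //; apply/subr0_eq/eqP; rewrite -normr_le0.
    apply/ler_addgt0Pl => e e0; rewrite addr0.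
    have C1 : 0 < `|C| + 1 by rewrite ltr_wpDl.
    have e2 : 0 < e / 2 by rewrite divr_gt0.
    have eC : 0 < e / 2 / (`|C| + 1) by rewrite divr_gt0.
    move/cvgrPdist_lt : cu => /(_ _ eC)[N1 _ uN].
    move/cvgrPdist_lt : vy => /(_ _ e2)[N2 _ vN].
    pose n := maxn N1 N2.
    rewrite (le_trans (ler_distD (v n) _ _))// [leRHS]splitr lerD//; last first.
      by rewrite distrC ltW// vN//= leq_maxr.
    rewrite -(uP n).2 -SB// (le_trans (SC _ _))//; first exact: closed_subspaceB.
    apply: (@le_trans _ _ ((`|C| + 1) * `|limn u - u n|)).
      by rewrite ler_wpM2r// (le_trans (ler_norm C))// lerDl.
    by rewrite mulrC -ler_pdivlMr// ltW// uN//= leq_maxl.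
  move=> r _ _ [x Mx <-] [z Mz <-]; exists (r *: x + z); first exact: Ml.
  by rewrite SL.
move=> y My; have [p [x Mx xp] orth] := projection_exists y sSM.
exists x => //; rewrite xp; apply/esym/subr0_eq.
have Myp : M (y - p) by rewrite -xp; apply: closed_subspaceB => //; exact: SM.
apply: normr_sqr_eq0; apply/eqP; rewrite eq_le sqr_ge0 andbT.
rewrite -(pmulr_rle0 _ A0) (le_trans (SA _ Myp))// innerC orth//.
by exists (y - p).
Qed.

End RealHilbert.

(** * The Abel-Dini theorem *)

(** Dividing the terms of a divergent series of nonnegative numbers by its
    partial sums preserves divergence, while dividing them by the squared partial
    sums forces convergence. The leading 1 in [s] keeps the divisors positive. *)
Section AbelDini.
Context {R : realType} (t : nat -> R) (t_ge0 : forall n, 0 <= t n).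

Let s n : R := 1 + \sum_(0 <= k < n.+1) t k.

Let sS n : s n.+1 = s n + t n.+1.
Proof. by rewrite /s big_nat_recr//= addrA. Qed.

Let s_ge1 n : 1 <= s n.
Proof. by rewrite lerDl sumr_ge0. Qed.

Let s_gt0 n : 0 < s n.
Proof. exact: lt_le_trans ltr01 (s_ge1 n). Qed.

(** The terms are dominated by those of the telescoping series of
    [(s k)^-1 - (s k.+1)^-1]. *)
Lemma abel_dini_converges n : \sum_(0 <= k < n) t k / s k ^+ 2 <= 1.
Proof.
have step (x y : R) : 0 < x -> x <= y -> (y - x) / y ^+ 2 <= x^-1 - y^-1.
  move=> x0 xy; have y0 := lt_le_trans x0 xy.
  have -> : x^-1 - y^-1 = (y - x) / (x * y) by field; rewrite !gt_eqF.
  rewrite ler_wpM2l ?subr_ge0// lef_pV2 ?posrE ?mulr_gt0 ?exprn_gt0//.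
  by rewrite expr2 ler_wpM2r// ltW.
case: n => [|n]; first by rewrite big_nil.
suff : \sum_(0 <= k < n.+1) t k / s k ^+ 2 <= 1 - (s n)^-1.
  by move=> /le_trans; apply; rewrite gerBl invr_ge0 ltW.
elim: n => [|n IHn].
  have -> : \sum_(0 <= k < 1) t k / s k ^+ 2 = (s 0%N - 1) / s 0%N ^+ 2.
    by rewrite /s !big_nat1 [1 + t 0%N]addrC addrK.
  by rewrite (le_trans (step _ _ ltr01 (s_ge1 0%N)))// invr1.
have -> : \sum_(0 <= k < n.+2) t k / s k ^+ 2 =
    \sum_(0 <= k < n.+1) t k / s k ^+ 2 + (s n.+1 - s n) / s n.+1 ^+ 2.
  by rewrite big_nat_recr//= sS [s n + _]addrC addrK.
have h : s n <= s n.+1 by rewrite sS lerDl.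
rewrite (le_trans (lerD IHn (step _ _ (s_gt0 n) h)))//.
by rewrite addrA subrK.
Qed.

(** If [X] and [Y] are the sums of [t] before [m] and over a block starting at
    [m], the weighted sum over that block is at least [Y / (1 + (X + Y))]. Past
    some [m] this is at most 1/2, whence [Y <= 1 + X] for all blocks. *)
Lemma abel_dini_diverges C :
  (forall n, \sum_(0 <= k < n) t k / s k <= C) ->
  exists D, forall n, \sum_(0 <= k < n) t k <= D.
Proof.
move=> bC.
pose D := range (fun n => \sum_(0 <= k < n) t k / s k).
have Ds : has_sup D.
  by split; [exists 0, 0%N => //; rewrite big_nil | exists C => _ [n _ <-]].
have h2 : 0 < 2^-1 :> R by rewrite invr_gt0.
have [_ [m _ <-] mP] := sup_adherent h2 Ds.
set X := \sum_(0 <= k < m) t k; have X0 : 0 <= X by apply: sumr_ge0.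
exists (2 * (1 + X)) => n; have [nm|] := leqP n m.
  rewrite (@le_trans _ _ X)//; last by lra.
  by rewrite /X (@big_cat_nat _ _ _ n 0 m)//= lerDl sumr_ge0.
case: n => [//|n]; rewrite ltnS => mn.
rewrite (@big_cat_nat _ _ _ m 0 n.+1)//= ?leqW// -/X.
set Y := \sum_(m <= k < n.+1) t k.
have Yle : Y / s n <= 2^-1.
  rewrite (@le_trans _ _ (\sum_(m <= k < n.+1) t k / s k))//.
    rewrite /Y mulr_suml; apply: ler_sum_nat => k /andP[mk kn].
    rewrite ler_wpM2l// lef_pV2 ?posrE//.
    by rewrite /s lerD2l (@big_cat_nat _ _ _ k.+1 0 n.+1)//= lerDl sumr_ge0.
  have : \sum_(0 <= k < n.+1) t k / s k <= sup D.
    by apply: ub_le_sup; [exact: Ds.2 | exists n.+1].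
  by rewrite (@big_cat_nat _ _ _ m 0 n.+1)//= ?leqW//; move: mP; lra.
have snE : s n = 1 + (X + Y) by rewrite /s (@big_cat_nat _ _ _ m 0 n.+1)//= leqW.
move: Yle; rewrite ler_pdivrMr// snE; lra.
Qed.

End AbelDini.

(** * Series along an enumeration *)

Section SeriesAlong.
Context {I : Type} (e : nat -> option I).

Lemma series_along0 {K : numFieldType} {V : normedModType K} (u : I -> V) :
  series_along e u 0 = 0.
Proof. by rewrite /series_along /series /= big_geq. Qed.

Lemma series_alongS {K : numFieldType} {V : normedModType K} (u : I -> V) n :
  series_along e u n.+1 =
  series_along e u n + (if e n is Some i then u i else 0).
Proof. exact: seriesSr. Qed.

Lemma series_along_eq0 {K : numFieldType} {V : normedModType K} (u : I -> V) n :
  (forall i, u i = 0) -> series_along e u n = 0.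
Proof.
move=> u0; elim: n => [|n IHn]; first by rewrite series_along0.
by rewrite series_alongS IHn add0r; case: (e n).
Qed.

Lemma series_along_morph {K K' : numFieldType} {V : normedModType K}
    {V' : normedModType K'} (phi : V -> V') (u : I -> V) n :
  phi 0 = 0 -> {morph phi : x y / x + y} ->
  phi (series_along e u n) = series_along e (fun i => phi (u i)) n.
Proof.
move=> phi0 phiD; elim: n => [|n IHn]; first by rewrite !series_along0.
by rewrite !series_alongS phiD IHn; case: (e n) => //=; rewrite phi0.
Qed.

Lemma series_along_linear {K : numFieldType} {V : normedModType K} (r : K)
    (u w : I -> V) n :
  series_along e (fun i => r *: u i + w i) n =
  r *: series_along e u n + series_along e w n.
Proof.
elim: n => [|n IHn]; first by rewrite !series_along0 scaler0 addr0.
rewrite !series_alongS IHn scalerDr addrACA; congr (_ + _).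
by case: (e n) => //; rewrite scaler0 addr0.
Qed.

Lemma series_along_single {K : numFieldType} {V : normedModType K}
    (u : I -> V) (i : I) : enumeration e -> (forall j, j <> i -> u j = 0) ->
  series_along e u @ \oo --> u i.
Proof.
move=> [e_inj e_surj _] u0; have [N eN] := e_surj i.
have uE n : series_along e u n = if (N < n)%N then u i else 0.
  elim: n => [|n IHn]; first by rewrite series_along0.
  rewrite series_alongS IHn ltnS; case: (ltngtP N n) => [Nn|nN|Nn].
  - case en : (e n) => [j|]; last by rewrite addr0.
    rewrite (u0 j) ?addr0// => ji; move: Nn.
    by rewrite (e_inj N n i)// ?ltnn// en ji.
  - case en : (e n) => [j|]; last by rewrite addr0.
    rewrite (u0 j) ?addr0// => ji; move: nN.
    by rewrite (e_inj N n i)// ?ltnn// en ji.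
  - by rewrite -Nn eN add0r.
apply/cvgrPdist_le => r r0; exists N.+1 => // n /= Nn.
by rewrite uE Nn subrr normr0 ltW.
Qed.

Section Limits.
Context {K : numFieldType} {V : normedModType K}.
Implicit Types u w : I -> V.

Lemma sum_along_eq u l : series_along e u @ \oo --> l -> sum_along e u = l.
Proof. by move=> ul; apply: cvg_lim ul => //; exact: norm_hausdorff. Qed.

Lemma cvg_along_linear (r : K) u w : convergent_along e u ->
  convergent_along e w ->
  series_along e (fun i => r *: u i + w i) @ \oo -->
  r *: sum_along e u + sum_along e w.
Proof.
move=> cu cw; rewrite (funext (series_along_linear r u w)).
by apply: cvgD => //; exact: cvgZl_tmp.
Qed.

Lemma sum_along_linear (r : K) u w : convergent_along e u ->
  convergent_along e w ->
  sum_along e (fun i => r *: u i + w i) = r *: sum_along e u + sum_along e w.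
Proof. by move=> cu cw; apply: sum_along_eq; exact: cvg_along_linear. Qed.

End Limits.

Section Nonnegative.
Context {R : realType}.
Implicit Types (u w : I -> R) (C : R).

Lemma series_along_comb (r s : R) u w n :
  series_along e (fun i => r * u i + s * w i) n =
  r * series_along e u n + s * series_along e w n.
Proof.
elim: n => [|n IHn]; first by rewrite !series_along0 !mulr0 addr0.
by rewrite !series_alongS IHn !mulrDr addrACA; case: (e n); rewrite ?mulr0 ?addr0.
Qed.

Lemma series_along_ge0 u n : (forall i, 0 <= u i) -> 0 <= series_along e u n.
Proof.
move=> u0; elim: n => [|n IHn]; first by rewrite series_along0.
by rewrite series_alongS addr_ge0//; case: (e n).
Qed.

Lemma series_along_block_le u w m n : (forall i, u i <= w i) -> (m <= n)%N ->
  series_along e u n - series_along e u m <=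
  series_along e w n - series_along e w m.
Proof.
move=> uw /subnKC <-; elim: (n - m)%N => [|p IHp]; first by rewrite addn0 !subrr.
rewrite addnS !series_alongS addrAC [leRHS]addrAC lerD//.
by case: (e _).
Qed.

Lemma series_along_le u w n : (forall i, u i <= w i) ->
  series_along e u n <= series_along e w n.
Proof.
by move=> uw; have := series_along_block_le uw (leq0n n); rewrite !series_along0 !subr0.
Qed.

Lemma nondecreasing_series_along u : (forall i, 0 <= u i) ->
  {homo series_along e u : m n / (m <= n)%N >-> m <= n}.
Proof.
move=> u0; apply/nondecreasing_seqP => n; rewrite series_alongS lerDl.
by case: (e n).
Qed.

Lemma bounded_convergent_along u C : (forall i, 0 <= u i) ->
  (forall n, series_along e u n <= C) -> convergent_along e u.
Proof.
move=> u0 uC; apply: nondecreasing_is_cvgn.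
  exact: nondecreasing_series_along.
by exists C => _ [n _ <-].
Qed.

Lemma series_along_le_sum u n : (forall i, 0 <= u i) ->
  convergent_along e u -> series_along e u n <= sum_along e u.
Proof.
move=> u0 cu; apply: nondecreasing_cvgn_le => //.
exact: nondecreasing_series_along.
Qed.

Lemma sum_along_le u C : convergent_along e u ->
  (forall n, series_along e u n <= C) -> sum_along e u <= C.
Proof. by move=> cu uC; apply: limr_le => //; apply: nearW. Qed.

End Nonnegative.
End SeriesAlong.

(** * Analysis and synthesis over the reals *)

Lemma adjoint_linear {K : numFieldType} {theta : K -> K}
    {U V : hilbertType theta} (f : U -> V) (g : V -> U) (r : K) (y z : V) :
  (forall x y, inner (f x) y = inner x (g y)) ->
  g (r *: y + z) = r *: g y + g z.
Proof.
move=> fg; apply/subr0_eq/eqP; rewrite -normr_eq0 -sqrf_eq0 -inner_norm.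
move: (X in inner X _) => x.
by rewrite innerBr innerDr innerZr -!fg innerDr innerZr subrr.
Qed.

(** The model for [a i] is [v_i Lambda_i pi_(W_i)], with adjoint [b i]. *)
Section Frames.
Context {R : realType} {V : hilbertType (@idfun R)} {I : eqType}.
Context (e : nat -> option I) {G : I -> hilbertType (@idfun R)}.
Context (a : forall i, V -> G i) (b : forall i, G i -> V).
Arguments b : clear implicits.
Hypothesis adj : forall i x y, inner (a i x) y = inner x (b i y).
Implicit Types (c d : forall i, G i) (r : R) (x y z f h : V) (M : set V).

Let T c : nat -> V := series_along e (fun i => b i (c i)).
Let sigma c : nat -> R := series_along e (fun i => `|c i| ^+ 2).
Let analysis f i : G i := a i f.
Let range_synthesis : set V := [set sum_along e (fun i => b i (c i)) | c in ell2 e].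
Let well_defined := forall c, ell2 e c -> convergent_along e (fun i => b i (c i)).

Lemma synthesis_linear r i (y z : G i) : b i (r *: y + z) = r *: b i y + b i z.
Proof. by apply: (adjoint_linear (f := a i)). Qed.

Lemma analysis_linear r i x y : a i (r *: x + y) = r *: a i x + a i y.
Proof. by apply: (adjoint_linear (f := b i)) => y' x'; rewrite innerC -adj innerC. Qed.

Lemma synthesis0 i : b i 0 = 0.
Proof.
by have := synthesis_linear (-1) (0 : G i) 0; rewrite scaler0 addr0 scaleN1r addNr.
Qed.

Lemma analysis0 i : a i 0 = 0.
Proof. by have := analysis_linear (-1) i 0 0; rewrite scaler0 addr0 scaleN1r addNr. Qed.

Lemma synthesisZ r i (y : G i) : b i (r *: y) = r *: b i y.
Proof. by rewrite -[r *: y]addr0 synthesis_linear synthesis0 addr0. Qed.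

Lemma analysisZ r i x : a i (r *: x) = r *: a i x.
Proof. by rewrite -[r *: x]addr0 analysis_linear analysis0 addr0. Qed.

Lemma sigma_ge0 c n : 0 <= sigma c n.
Proof. by apply: series_along_ge0 => i; exact: sqr_ge0. Qed.

Lemma ell2P c : ell2 e c <-> exists C, forall n, sigma c n <= C.
Proof.
split=> [cc|[C cC]].
  exists (sum_along e (fun i => `|c i| ^+ 2 : R)) => n.
  by apply: series_along_le_sum => // i; exact: sqr_ge0.
by apply: bounded_convergent_along cC => i; exact: sqr_ge0.
Qed.

Lemma sigmaZ r c n : sigma (fun i => r *: c i) n = r ^+ 2 * sigma c n.
Proof.
rewrite /sigma; under eq_fun do rewrite sqr_normZ.
by rewrite -(series_along_morph e (phi := *%R (r ^+ 2))) ?mulr0//; exact: mulrDr.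
Qed.

Lemma ell2_linear r c d : ell2 e c -> ell2 e d -> ell2 e (fun i => r *: c i + d i).
Proof.
move=> /ell2P[C cC] /ell2P[D dD]; apply/ell2P.
exists (2 * r ^+ 2 * C + 2 * D) => n.
have : series_along e (fun i => `|r *: c i + d i| ^+ 2) n <=
    series_along e (fun i => 2 * r ^+ 2 * `|c i| ^+ 2 + 2 * `|d i| ^+ 2) n.
  apply: series_along_le => i.
  have := parallelogram (r *: c i) (d i); rewrite sqr_normZ.
  have := sqr_ge0 (`|r *: c i - d i|).
  by lra.
rewrite series_along_comb => /le_trans; apply.
by apply: lerD; apply: ler_wpM2l => //; [rewrite mulr_ge0 ?sqr_ge0 | exact: cC | exact: dD].
Qed.

Lemma inner_synthesis c z n :
  inner (T c n) z = series_along e (fun i => inner (c i) (a i z)) n.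
Proof.
rewrite (series_along_morph e (phi := fun x => inner x z : R)) ?inner0l//.
  by congr series_along; apply/funext => i; rewrite innerC -adj innerC.
by move=> x y; exact: innerDl.
Qed.

(** Cauchy-Schwarz in [ell2], in additive form. The free weight [t] is set
    to the Bessel bound in [synthesis_block_le]. *)
Lemma inner_synthesis_block_le t c z m n : 0 < t -> (m <= n)%N ->
  2 * inner (T c n - T c m) z <=
  t * (sigma c n - sigma c m) +
  t^-1 * (sigma (analysis z) n - sigma (analysis z) m).
Proof.
move=> t0 mn; rewrite innerBl !inner_synthesis.
(* [0 * 0] gives the summand the shape of [series_along_comb] *)
have := series_along_block_le e (u := fun i => 2 * inner (c i) (a i z) + 0 * 0)
    (w := fun i => t * `|c i| ^+ 2 + t^-1 * `|a i z| ^+ 2) _ mn.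
rewrite !series_along_comb !mul0r !addr0 -/(sigma _ _) -/(sigma _ _).
move=> /(_ (fun i => _)) H; rewrite mulrBr (le_trans (H _))//.
  by move=> i; rewrite addr0; exact: inner_le_sqr.
rewrite /sigma /analysis; lra.
Qed.

Lemma inner_sum_le c z (C : R) : convergent_along e (fun i => b i (c i)) ->
  (forall n, inner (T c n) z <= C) ->
  inner (sum_along e (fun i => b i (c i))) z <= C.
Proof.
move=> cc le_C; have cz := cvg_inner (z := z) cc.
rewrite -(cvg_lim (@norm_hausdorff _ R) cz).
by apply: limr_le; [apply/cvg_ex; eexists; exact: cz | exact: nearW].
Qed.

(** This turns a lower frame bound into coercivity of the frame operator. *)
Lemma synthesis_analysisE f :
  convergent_along e (fun i => b i (a i f)) ->
  inner (sum_along e (fun i => b i (a i f))) f =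
  sum_along e (fun i => `|a i f| ^+ 2).
Proof.
move=> cc; apply/esym/sum_along_eq.
have -> : series_along e (fun i => `|a i f| ^+ 2) =
    (fun n => inner (T (analysis f) n) f).
  apply/funext => n; rewrite inner_synthesis; congr series_along.
  by apply/funext => i; rewrite inner_norm.
exact: cvg_inner.
Qed.

Section Bessel.
Context (M : set V) (B : R).
Hypotheses (sM : closed_subspace M) (Mb : forall i (y : G i), M (b i y)) (B0 : 0 < B).
Hypothesis bessel : forall h, M h -> forall n, sigma (analysis h) n <= B * `|h| ^+ 2.

Lemma synthesis_partial_in c n : M (T c n).
Proof.
have [_ M0 _] := sM; elim: n => [|n IHn]; first by rewrite /T series_along0.
rewrite /T series_alongS; apply: closed_subspaceD => //.
by case: (e n).
Qed.

(** The dual form of the Bessel inequality: it bounds the blocks of the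
    synthesis series by those of a convergent series. *)
Lemma synthesis_block_le c m n : (m <= n)%N ->
  `|T c n - T c m| ^+ 2 <= B * (sigma c n - sigma c m).
Proof.
move=> mn; set h := T c n - T c m.
(* duality: [h] is tested against itself *)
have Mh : M h by apply: closed_subspaceB => //; exact: synthesis_partial_in.
have := inner_synthesis_block_le c h B0 mn; rewrite -/h inner_norm.
have : B^-1 * (sigma (analysis h) n - sigma (analysis h) m) <= `|h| ^+ 2.
  rewrite -[leRHS](mulKf (x := B)) ?gt_eqF// ler_wpM2l ?invr_ge0 ?(ltW B0)//.
  by rewrite lerBlDr (le_trans (bessel Mh n))// lerDl sigma_ge0.
by lra.
Qed.

Lemma bessel_convergent c : ell2 e c -> convergent_along e (fun i => b i (c i)).
Proof.
move=> ec; set s := sum_along e (fun i => `|c i| ^+ 2 : R).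
apply: (cvg_of_dist (b := fun m => B * (s - sigma c m))).
  rewrite -(mulr0 B) -(subrr s).
  by apply: cvgM; [exact: cvg_cst | apply: cvgB => //; exact: cvg_cst].
move=> m n mn; rewrite (le_trans (synthesis_block_le c mn))//.
rewrite ler_wpM2l ?(ltW B0)// lerB// series_along_le_sum// => i.
exact: sqr_ge0.
Qed.

Lemma synthesis_in c : ell2 e c -> M (sum_along e (fun i => b i (c i))).
Proof.
move=> ec; have [cM _ _] := sM; apply: (cvg_closed cM).
  exact: (synthesis_partial_in c).
exact: bessel_convergent.
Qed.

Lemma synthesis_norm_le c C : (forall n, sigma c n <= C) ->
  `|sum_along e (fun i => b i (c i))| ^+ 2 <= B * C.
Proof.
move=> cC; set x := sum_along e _.
have cc : convergent_along e (fun i => b i (c i)).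
  by apply: bessel_convergent; apply/ell2P; exists C.
have : inner x x <= 2^-1 * (B * C + `|x| ^+ 2).
  apply: inner_sum_le => // n.
  have := inner_le_sqr (T c n) x ltr01; rewrite invr1 !mul1r.
  have := synthesis_block_le c (leq0n n).
  rewrite {2}/T {2}/sigma !series_along0 !subr0.
  have := ler_wpM2l (ltW B0) (cC n); lra.
by rewrite inner_norm; lra.
Qed.

Lemma bessel_analysis_ell2 f : M f -> ell2 e (analysis f).
Proof. by move=> Mf; apply/ell2P; exists (B * `|f| ^+ 2); exact: bessel. Qed.

(** With a lower frame bound, the frame operator is coercive, hence onto [M];
    and its values are synthesized from the analysis of vectors. *)
Lemma frame_synthesis_onto (A : R) : 0 < A ->
  (forall f, M f -> A * `|f| ^+ 2 <= sum_along e (fun i => `|a i f| ^+ 2)) ->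
  M `<=` range_synthesis.
Proof.
move=> A0 lowA y My.
pose S f := sum_along e (fun i => b i (a i f)).
have [||||x Mx Sx] := @lax_milgram _ _ M S A B sM _ _ _ A0 _ y My.
- by move=> f Mf; apply: synthesis_in; exact: bessel_analysis_ell2.
- move=> r f h Mf Mh; rewrite /S -sum_along_linear; first last.
  + by apply: bessel_convergent; exact: (bessel_analysis_ell2 Mh).
  + by apply: bessel_convergent; exact: (bessel_analysis_ell2 Mf).
  + congr sum_along; apply/funext => i.
    by rewrite analysis_linear synthesis_linear.
- move=> f Mf; rewrite -ler_sqr ?nnegrE ?mulr_ge0 ?(ltW B0)// exprMn expr2 -mulrA.
  exact: (synthesis_norm_le (bessel Mf)).
- move=> f Mf; rewrite synthesis_analysisE ?lowA//.
  by apply: bessel_convergent; exact: (bessel_analysis_ell2 Mf).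
- by exists (analysis x) => //; exact: bessel_analysis_ell2.
Qed.

End Bessel.

Section Converse.
Hypothesis e_enum : enumeration e.
Hypothesis wd : well_defined.

(** Otherwise the Abel-Dini weights turn [analysis h] into an element of
    [ell2] whose synthesis series diverges when tested against [h]. *)
Lemma analysis_ell2 h : ell2 e (analysis h).
Proof.
have [e_inj e_surj _] := e_enum; have [idx idxP] := choice e_surj.
pose t n : R := if e n is Some i then `|a i h| ^+ 2 else 0.
have t0 n : 0 <= t n by rewrite /t; case: (e n) => // i; exact: sqr_ge0.
pose s n : R := 1 + \sum_(0 <= k < n.+1) t k.
have s0 n : 0 < s n by rewrite ltr_wpDr ?sumr_ge0.
pose c i : G i := (s (idx i))^-1 *: a i h.
have idxE n i : e n = Some i -> idx i = n by move=> en; exact: e_inj (idxP i) en.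
have ec : ell2 e c.
  apply/ell2P; exists 1 => n; apply: le_trans (abel_dini_converges t0 n).
  rewrite le_eqVlt; apply/orP; left; apply/eqP; apply: eq_bigr => k _.
  rewrite -/(s k) /t; case ek : (e k) => [i|]; last by rewrite mul0r.
  by rewrite /c (idxE _ _ ek) sqr_normZ exprVn mulrC.
have cc := cvg_inner (z := h) (wd ec).
have [C [_ bC]] := @cvg_seq_bounded _ _ _ (cvgP _ cc).
have [|D tD] := @abel_dini_diverges _ t t0 (C + 1); last by apply/ell2P; exists D.
move=> n; have := bC (C + 1); rewrite ltrDl => /(_ ltr01 n Logic.I).
apply: le_trans; apply: le_trans (ler_norm _).
rewrite -/(T c n) inner_synthesis le_eqVlt; apply/orP; left; apply/eqP.
apply: eq_bigr => k _; rewrite -/(s k) /t; case ek : (e k) => [i|]; last by rewrite mul0r.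
by rewrite /c (idxE _ _ ek) innerZl inner_norm mulrC.
Qed.

Lemma setT_closed_subspace : closed_subspace [set: V].
Proof. by split=> //; exact: closedT. Qed.

(** By [analysis_ell2], the synthesized vectors with coefficients in the unit
    ball of [ell2] are weakly bounded, hence bounded: synthesis is a bounded
    operator, and so is its adjoint. *)
Lemma analysis_bessel :
  exists2 D, 0 < D & forall h n, sigma (analysis h) n <= D * `|h| ^+ 2.
Proof.
pose E z s := exists c n, z = T c n /\ s = sigma c n.
have [||r _ _ [c [n [-> ->]]]|x _|D D0 ED] :=
  weakly_bounded_quadratic (E := E) setT_closed_subspace.
- by [].
- by move=> _ _ [c [n [_ ->]]]; exact: sigma_ge0.
- exists (fun i => r *: c i), n; split; last by rewrite sigmaZ.
  rewrite /T (series_along_morph e (phi := fun x => r *: x)) ?scaler0//.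
    by congr series_along; apply/funext => i; rewrite synthesisZ.
  exact: scalerDr.
- have [C xC] := (ell2P _).1 (@analysis_ell2 x).
  exists (1 + C) => _ _ [c [n [-> ->]]] sc.
  have := inner_synthesis_block_le c x ltr01 (leq0n n).
  rewrite {2}/T {2 4}/sigma !series_along0 !subr0 invr1 !mul1r innerC.
  have := xC n; have := sigma_ge0 c n; have := sigma_ge0 (analysis x) n.
  rewrite innerC; lra.
exists D => // h n.
have h1 : `|T (analysis h) n| ^+ 2 <= D * sigma (analysis h) n.
  by apply: ED; exists (analysis h), n.
have := inner_le_sqr (T (analysis h) n) h (t := D^-1).
rewrite invr_gt0 invrK inner_synthesis => /(_ D0).
have -> : series_along e (fun i => inner (analysis h i) (a i h)) n = sigma (analysis h) n.
  by congr series_along; apply/funext => i; rewrite inner_norm.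
have : D^-1 * `|T (analysis h) n| ^+ 2 <= sigma (analysis h) n.
  by rewrite mulrC ler_pdivrMr// mulrC.
by lra.
Qed.

(** An open mapping argument in dual form. Testing a synthesized vector
    against [z] costs at most the norm of its coefficients times that of the
    analysis of [z]; when synthesis reaches all of [M], the vectors of [M] with
    analysis in the unit ball are thus weakly bounded, hence bounded. *)
Lemma analysis_lower_bound M : closed_subspace M -> M `<=` range_synthesis ->
  exists2 D, 0 < D & forall z s, M z ->
    (forall n, sigma (analysis z) n <= s) -> `|z| ^+ 2 <= D * s.
Proof.
move=> sM MT.
pose E z s := M z /\ forall n, sigma (analysis z) n <= s.
have [|z s [_ /(_ 0%N)]|r z s [Mz zs]|x /MT [c ec <-]|D D0 ED] :=
  weakly_bounded_quadratic (E := E) sM.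
- by move=> z s [].
- by rewrite /sigma series_along0.
- split; first exact: closed_subspaceZ.
  move=> n; rewrite (_ : analysis _ = (fun i => r *: analysis z i)).
    by rewrite sigmaZ ler_wpM2l ?sqr_ge0.
  by apply: functional_extensionality_dep => i; rewrite /analysis analysisZ.
- have [C cC] := (ell2P _).1 ec.
  exists (1 + C) => z s [_ zs] s1; apply: inner_sum_le; first exact: wd.
  move=> n.
  have := inner_synthesis_block_le c z ltr01 (leq0n n).
  rewrite {2}/T {2 4}/sigma !series_along0 !subr0 invr1 !mul1r.
  have := cC n; have := zs n; have := sigma_ge0 c n.
  have := sigma_ge0 (analysis z) n; lra.
by exists D => // z s Mz zs; apply: ED.
Qed.

Lemma range_synthesis_subspace : closed range_synthesis ->
  closed_subspace range_synthesis.
Proof.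
move=> cT; split => //.
  exists (fun i => 0); first apply/ell2P.
    by exists 0 => n; rewrite /sigma series_along_eq0// => i; rewrite normr0 expr0n.
  apply: sum_along_eq; apply: cvg_near_cst; apply: nearW => n.
  by rewrite series_along_eq0// => i; exact: synthesis0.
move=> r _ _ [c ec <-] [d ed <-]; exists (fun i => r *: c i + d i).
  exact: ell2_linear.
rewrite -sum_along_linear; [|exact: wd|exact: wd].
by congr sum_along; apply/funext => i; rewrite synthesis_linear.
Qed.

Lemma range_synthesis_gen i (y : G i) : range_synthesis (b i y).
Proof.
pose c := dfwith (fun j => 0 : G j) y.
have c0 j : j <> i -> c j = 0 by move=> /eqP ji; rewrite /c dfwith_out// eq_sym.
have ci : c i = y by rewrite /c dfwith_in.
exists c.
  apply/cvg_ex; eexists; apply: (@series_along_single _ _ _ _ _ i) => // j /c0 ->.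
  by rewrite normr0 expr0n.
rewrite -ci; apply: sum_along_eq.
apply: (@series_along_single _ _ _ _ (fun i => b i (c i)) i) => // j /c0 ->.
exact: synthesis0.
Qed.

End Converse.

(** [M] is the closed span of the ranges of the [b i], in the form of its
    universal property. *)
Theorem frame_iff_synthesis_closed_range M : enumeration e ->
  closed_subspace M -> (forall i (y : G i), M (b i y)) ->
  (forall N, closed_subspace N -> (forall i (y : G i), N (b i y)) -> M `<=` N) ->
  (exists A B : R, [/\ 0 < A, A <= B & forall f, M f ->
    let u i := `|a i f| ^+ 2 in
    [/\ convergent_along e u, A * `|f| ^+ 2 <= sum_along e u
      & sum_along e u <= B * `|f| ^+ 2]]) <->
  (well_defined /\ closed range_synthesis).
Proof.
move=> e_enum sM Mb minM; split=> [[A [B [A0 AB AfB]]]|[wd cT]].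
  have B0 := lt_le_trans A0 AB.
  have bessel h : M h -> forall n, sigma (analysis h) n <= B * `|h| ^+ 2.
    move=> Mh n; have [cu _] := AfB _ Mh; apply: le_trans.
    by apply: series_along_le_sum => // i; exact: sqr_ge0.
  split=> [c|]; first exact: (bessel_convergent sM Mb B0 bessel).
  suff -> : range_synthesis = M by case: sM.
  apply/seteqP; split=> [_ [c ec <-]|].
    exact: (synthesis_in sM Mb B0 bessel).
  apply: (frame_synthesis_onto sM Mb B0 bessel A0) => f Mf.
  by have [] := AfB _ Mf.
have [B B0 bessel] := analysis_bessel e_enum wd.
have MT : M `<=` range_synthesis.
  apply: minM => [|i y]; first exact: range_synthesis_subspace.
  exact: range_synthesis_gen.
have [D D0 lowD] := analysis_lower_bound wd sM MT.
exists D^-1, (Num.max B D^-1); split; [by rewrite invr_gt0|by rewrite le_max lexx orbT|].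
move=> f Mf u; have cu : convergent_along e u by exact: analysis_ell2.
split=> //.
  rewrite mulrC ler_pdivrMr// mulrC; apply: lowD => // n.
  by apply: series_along_le_sum => // i; exact: sqr_ge0.
apply: sum_along_le => // n; rewrite (le_trans (bessel f n))//.
by rewrite ler_wpM2r ?sqr_ge0// le_max lexx.
Qed.

End Frames.

(** * From real Hilbert spaces back to the given scalars *)

Section SeriesEmb.
Context {R : realType} {k : scalar_kind} {I : Type} (e : nat -> option I).
Implicit Types w : I -> R.

Lemma cvg_emb (u : nat -> R) (l : R) :
  u @ \oo --> l -> (fun n => emb k (u n)) @ \oo --> emb k l.
Proof.
move=> ul; apply/cvgrPdist_le => r r0.
have rr0 : 0 < re r by rewrite -(@ltr_emb R k) rmorph0 emb_re ?ltW.
move/cvgrPdist_le : ul => /(_ _ rr0); apply: filterS => n.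
by rewrite -(@ler_emb R k) emb_re ?(ltW r0)// -norm_emb rmorphB.
Qed.

Lemma cvg_re (u : nat -> scalars R k) (l : scalars R k) :
  u @ \oo --> l -> (fun n => re (u n)) @ \oo --> re l.
Proof.
move=> ul; apply/cvgrPdist_le => r r0.
have rr0 : 0 < emb k r by rewrite -(rmorph0 (emb k)) ltr_emb.
move/cvgrPdist_le : ul => /(_ _ rr0); apply: filterS => n.
rewrite -raddfB -(@ler_emb R k); apply: le_trans.
exact: emb_norm_re.
Qed.

Lemma series_along_emb w n :
  series_along e (fun i => emb k (w i)) n = emb k (series_along e w n).
Proof.
by rewrite (series_along_morph e (phi := emb k)) ?rmorph0//; exact: rmorphD.
Qed.

Lemma convergent_along_emb w :
  convergent_along e (fun i => emb k (w i)) <-> convergent_along e w.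
Proof.
rewrite /convergent_along (funext (series_along_emb w)).
split=> cw; apply/cvg_ex; eexists; last exact: cvg_emb cw.
have := cvg_re cw; under eq_fun do rewrite embK; exact.
Qed.

Lemma sum_along_emb w : convergent_along e w ->
  sum_along e (fun i => emb k (w i)) = emb k (sum_along e w).
Proof.
move=> cw; apply: sum_along_eq; rewrite (funext (series_along_emb w)).
exact: cvg_emb.
Qed.

End SeriesEmb.

Section Specifications.
Context {R : realType} {k : scalar_kind}.
Implicit Types H U V : hilbertType (@scalar_conj R k).

Lemma realified_subspace H (W : set H) :
  closed_subspace W -> closed_subspace (W : set (realified H)).
Proof.
move=> [cW W0 Wl]; split=> // r x y Wx Wy; exact: (Wl (emb k r)).
Qed.

(** The projection onto [W] for the real structure has residue orthogonal to
    [W] for the real part of the inner product only; [re_conjM_eq0] upgrades this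
    because [W] is stable under all scalars. *)
Lemma proj_spec H (W : set H) (x : H) : closed_subspace W ->
  W (proj W x) /\ forall z, W z -> inner (x - proj W x) z = 0.
Proof.
move=> sW; rewrite /proj.
apply: (@xgetPex _ 0 [set y | W y /\ forall z, W z -> inner (x - y) z = 0]).
have [y Wy orth] := projection_exists (x : realified H) (realified_subspace sW).
exists y; split=> // z Wz; apply: re_conjM_eq0.
have [_ W0 Wl] := sW.
set s := inner _ _; rewrite -innerZr.
by have := orth (s *: (z : H)); apply; rewrite -[_ *: _]addr0; exact: Wl.
Qed.

Lemma adjoint_spec U V (L : {linear U -> V}) : bounded_operator L ->
  forall x y, inner (L x) y = inner x (adjoint L y).
Proof.
move=> [C bC] x y; rewrite /adjoint.
move: x; apply: (@xgetPex _ 0 [set z | forall x, inner (L x) y = inner x z]).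
have [r v w||z zP] := @riesz R (realified U)
  (fun x => rinner (L x : realified V) y) (re `|C| * `|y : realified V|).
- by rewrite /rinner -reZ -raddfD -innerZl -innerDl -linearP.
- move=> x; rewrite (le_trans (cauchy_schwarz (L x : realified V) y))//.
  rewrite mulrAC ler_wpM2r// -(@ler_emb R k) rmorphM/= emb_re// !emb_rnorm.
  apply: le_trans (bC x) _.
  have Cx0 : 0 <= C * `|x : U| := le_trans (normr_ge0 (L x)) (bC x).
  by rewrite -[leLHS](ger0_norm Cx0) normrM normr_id.
exists z => x /=; apply/subr0_eq/re_conjM_eq0.
set s := inner _ _ - _.
rewrite mulrBr -!innerZl -linearZ raddfB.
by apply/eqP; rewrite subr_eq0; apply/eqP; exact: (zP (scalar_conj s *: x)).
Qed.

End Specifications.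

(** * g-fusion frame sequences *)

Section GFusion.
Context {R : realType} {k : scalar_kind} {H : hilbertType (@scalar_conj R k)}.
Context {I : eqType} (e : nat -> option I).
Context {HI : I -> hilbertType (@scalar_conj R k)}.
Context (W : I -> set H) (L : forall i, {linear H -> HI i}).
Context (v : I -> scalars R k).
Hypothesis W_closed : forall i, closed_subspace (W i).
Hypothesis L_bounded : forall i, bounded_operator (L i).
Hypothesis v_gt0 : forall i, 0 < v i.

Definition gfusion_analysis i (x : H) : HI i := v i *: L i (proj (W i) x).
Definition gfusion_synthesis i (y : HI i) : H :=
  v i *: proj (W i) (adjoint (L i) y).

Lemma proj_self_adjoint i (x y : H) :
  inner (proj (W i) x) y = inner x (proj (W i) y).
Proof.
have [Px xP] := proj_spec x (W_closed i).
have [Py yP] := proj_spec y (W_closed i).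
have -> : inner (proj (W i) x) y = inner (proj (W i) x) (proj (W i) y).
  apply/subr0_eq; rewrite -innerBr inner_conj yP//.
  by have := @scalar_conj_emb R k 0; rewrite rmorph0.
by apply/esym/subr0_eq; rewrite -innerBl xP.
Qed.

Lemma gfusion_adjoint i (x : H) (y : HI i) :
  inner (gfusion_analysis i x) y = inner x (gfusion_synthesis y).
Proof.
rewrite innerZl innerZr (adjoint_spec (L_bounded i)) proj_self_adjoint.
by rewrite -[v i]emb_re ?(ltW (v_gt0 i))// scalar_conj_emb.
Qed.

Lemma gfusion_synthesisZ i c (y : HI i) :
  gfusion_synthesis (c *: y) = c *: gfusion_synthesis y.
Proof.
have lin := adjoint_linear _ _ _ (gfusion_adjoint (i := i)).
have s0 : gfusion_synthesis (0 : HI i) = 0.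
  by have := lin (-1) 0 0; rewrite scaler0 addr0 scaleN1r addNr.
by have := lin c y 0; rewrite s0 !addr0.
Qed.

Local Notation M := (closed_span_of_ranges W L).

Lemma closed_span_gen i (y : HI i) : M (gfusion_synthesis y).
Proof.
apply: subset_closure; exists 1%N, (fun=> v i), (fun=> proj (W i) (adjoint (L i) y)).
by split=> [_|]; [exists i => //; exists y | rewrite big_ord1].
Qed.

Lemma closed_span_subspace : closed_subspace (M : set (realified H)).
Proof.
split; first exact: closed_closure.
  apply: subset_closure; exists 0%N, (fun=> 0), (fun=> 0).
  by split=> [[]//|]; rewrite big_ord0.
move=> r x y Mx My.
have [u uM ux] := @closure_cvg R (realified H) _ x Mx.
have [w wM wy] := @closure_cvg R (realified H) _ y My.
apply: (cvg_closed (u := fun n => r *: u n + w n)).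
- exact: closed_closure.
- move=> n; apply: subset_closure.
  have [p [c [g [gA ->]]]] := uM n; have [q [d [h [hA ->]]]] := wM n.
  exists (p + q)%N,
    (fun j => match fintype.split j with inl j => emb k r * c j | inr j => d j end),
    (fun j => match fintype.split j with inl j => g j | inr j => h j end).
  split=> [j|]; first by case: (fintype.split j).
  rewrite big_split_ord /= -[r *: _]/(emb k r *: _) scaler_sumr.
  congr (_ + _); apply: eq_bigr => j _.
    by rewrite (fintype.unsplitK (inl j)) scalerA.
  by rewrite (fintype.unsplitK (inr j)).
- by apply: cvgD => //; exact: cvgZl_tmp.
Qed.

(** [N] is only a real subspace, but the span is taken over all scalars: these
    are absorbed in the argument of the synthesis maps. *)
Lemma closed_span_min (N : set (realified H)) : closed_subspace N ->
  (forall i (y : HI i), N (gfusion_synthesis y)) -> M `<=` N.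
Proof.
move=> sN Nb; have [cN N0 _] := sN.
apply: subset_trans cN; apply: closure_subset => _ [n [c [g [gA ->]]]].
apply: (big_ind (N : H -> Prop)) => //.
  by move=> x y; exact: (closed_subspaceD sN).
move=> j _; have [i _ [y _ <-]] := gA j.
have vi : v i != 0 by rewrite gt_eqF.
have := Nb i ((c j / v i) *: y).
by rewrite gfusion_synthesisZ scalerA divfK.
Qed.

Lemma gfusion_norm i x :
  v i ^+ 2 * `|L i (proj (W i) x)| ^+ 2 =
  emb k (`|gfusion_analysis i x : realified (HI i)| ^+ 2).
Proof.
rewrite rmorphXn/= emb_rnorm normrZ exprMn.
by rewrite ger0_norm// ltW.
Qed.

Let a i (x : realified H) : realified (HI i) := gfusion_analysis i x.
Let b i (y : realified (HI i)) : realified H := gfusion_synthesis y.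

Lemma ell2_realified (f : forall i, HI i) :
  ell2 e f <-> ell2 e (f : forall i, realified (HI i)).
Proof.
have E : (fun i => `|f i| ^+ 2) =
    (fun i => emb k (`|f i : realified (HI i)| ^+ 2)).
  by apply/funext => i; rewrite rmorphXn/= emb_rnorm.
rewrite /ell2 [mkset _ _]/(convergent_along _ _) E.
exact: convergent_along_emb.
Qed.

(** The bounds of a frame are positive, hence in the image of [emb]. *)
Lemma g_fusion_frame_for_realified (N : set H) :
  g_fusion_frame_for e W L v N <->
  exists A B : R, [/\ 0 < A, A <= B & forall f : realified H, N f ->
    let u i := `|a i f| ^+ 2 in
    [/\ convergent_along e u, A * `|f| ^+ 2 <= sum_along e u
      & sum_along e u <= B * `|f| ^+ 2]].
Proof.
have uE (f : H) : (fun i => v i ^+ 2 * `|L i (proj (W i) f)| ^+ 2) =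
    (fun i => emb k (`|a i f| ^+ 2)).
  by apply/funext => i; rewrite gfusion_norm.
have nE (A : R) (f : H) :
    emb k (A * `|f : realified H| ^+ 2) = emb k A * `|f| ^+ 2.
  by rewrite rmorphM rmorphXn/= emb_rnorm.
split=> [[A [B [A0 AB AfB]]]|[A [B [A0 AB AfB]]]].
  have B0 := lt_le_trans A0 AB.
  have [EA EB] := (emb_re (ltW A0), emb_re (ltW B0)).
  move: (re A) (re B) EA EB A0 AB AfB {B0} => A' B' <- <- A0 AB AfB.
  exists A', B'; split.
  - by rewrite -(@ltr_emb R k) rmorph0.
  - by rewrite -(@ler_emb R k).
  move=> f Nf u; have [] := AfB f Nf; rewrite /= uE => /convergent_along_emb cu.
  by rewrite sum_along_emb// -!nE !ler_emb.
exists (emb k A), (emb k B); split.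
- by rewrite -(rmorph0 (emb k)) ltr_emb.
- by rewrite ler_emb.
move=> f Nf u; have [cu] := AfB f Nf.
rewrite /u uE sum_along_emb// -!nE !ler_emb; split=> //.
exact/convergent_along_emb.
Qed.

Theorem g_fusion_frame_sequence_iff : enumeration e ->
  g_fusion_frame_sequence e W L v <->
  ((forall f : forall i, HI i, ell2 e f ->
      convergent_along e (synthesis_term W L v f)) /\
   closed [set synthesis e W L v f | f in ell2 e]).
Proof.
move=> e_enum.
have adj i (x : realified H) (y : realified (HI i)) :
    inner (a i x) y = inner x (b y).
  by congr re; exact: gfusion_adjoint.
have := frame_iff_synthesis_closed_range adj e_enum closed_span_subspace
  closed_span_gen closed_span_min.
have -> : @ell2 (scalars R k) _ I e HI =
    @ell2 R idfun I e (fun i => realified (HI i)).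
  apply/seteqP; split=> f; by move/ell2_realified.
move=> <-; exact: g_fusion_frame_for_realified.
Qed.

End GFusion.

Theorem theorem4p3 (R : realType) (k : scalar_kind)
    (H : hilbertType (@scalar_conj R k)) (J : set int)
    (HJ : J -> hilbertType (@scalar_conj R k))
    (e : nat -> option J)
    (W : J -> set H) (L : forall j : J, {linear H -> HJ j})
    (v : J -> scalars R k)
    (H_separable : separable H)
    (e_enum : enumeration e)
    (W_closed : forall j, closed_subspace (W j))
    (L_bounded : forall j, bounded_operator (L j))
    (v_gt0 : forall j, 0 < v j) :
  g_fusion_frame_sequence e W L v <->
  ((forall f : forall j, HJ j, ell2 e f ->
      convergent_along e (synthesis_term W L v f)) /\
   closed [set synthesis e W L v f | f in ell2 e]).
Proof. exact: g_fusion_frame_sequence_iff. Qed.
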